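(* Let $\nu,\mu$ be computable probability measures on Cantor space $2^{\mathbb{N}}$ with full support. Let $L(\tau)=-\ln \frac{\mu(\tau)}{\nu(\tau)}$ for $\tau\in 2^{<\mathbb{N}}$, which is a computable dyadic $\nu$-submartingale, and let $A$ be the predictable process from the Doob decomposition of $L$. Then, for all $n\ge 0$ and $\omega\in 2^{\mathbb{N}}$, $$D_{\mathscr{F}_{n+1}}(\nu \mid \mu)(\omega) = A(\omega\upharpoonright (n+1))-A(\omega\upharpoonright n).$$
   Context: A probability measure $\nu$ on Cantor space is identified with the function $\sigma\mapsto\nu(\sigma):=\nu([\sigma])$ on $2^{<\mathbb{N}}$, where $[\sigma]$ is the set of $\omega\in 2^{\mathbb{N}}$ extending $\sigma$. It is computable if the reals $\nu(\sigma)$ are computable uniformly in $\sigma$; it has full support if $\nu(\sigma)>0$ for all $\sigma$. $\omega\upharpoonright n$ is the length-$n$ initial segment of $\omega$. $\mathscr{F}_n$ is the $\sigma$-algebra generated by the sets $[\sigma]$ with $|\sigma|=n$. $\nu(\sigma\iota\mid\sigma)=\nu(\sigma\iota)/\nu(\sigma)$. Kullback-Leibler divergence: for probability measures $P\ll Q$ on a $\sigma$-algebra, $D(P\mid Q)=\mathbb{E}_P[\ln \frac{dP}{dQ}]$. $D_{\mathscr{F}_{n+1}}(\nu\mid\mu)(\omega)$ denotes $D(P\mid Q)$ where $P,Q$ are the restrictions to $\mathscr{F}_{n+1}$ of the conditional measures $\nu(\cdot\mid[\omega\upharpoonright n])$ and $\mu(\cdot\mid[\omega\upharpoonright n])$,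 respectively. A dyadic $\nu$-martingale is a function $M:2^{<\mathbb{N}}\to\mathbb{R}$ with $M(\sigma)=M(\sigma0)\nu(\sigma0\mid\sigma)+M(\sigma1)\nu(\sigma1\mid\sigma)$ for all $\sigma$; a dyadic $\nu$-submartingale is defined with $=$ replaced by $\le$; computable means $M(\sigma)$ is a computable real uniformly in $\sigma$. The Doob decomposition of a computable dyadic $\nu$-submartingale $L$ is the unique pair $(N,A)$ of a computable dyadic $\nu$-martingale $N$ and a non-negative computable $A:2^{<\mathbb{N}}\to\mathbb{R}$, increasing along extension of strings, such that $L=N+A$, $N(\emptyset)=L(\emptyset)$, and $A(\tau\iota)-A(\tau)=\big(L(\tau0)\nu(\tau0\mid\tau)+L(\tau1)\nu(\tau1\mid\tau)\big)-L(\tau)$ for all $\tau\in2^{<\mathbb{N}}$, $\iota\in\{0,1\}$. $A$ is called the predictable process. *)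

(* Defs.v *)
From HB Require Import structures.
From mathcomp Require Import all_boot all_order all_algebra.
From mathcomp Require Import all_classical all_reals all_analysis.
Set Implicit Arguments.
Unset Strict Implicit.
Unset Printing Implicit Defensive.
Import Order.TTheory GRing.Theory Num.Theory.
Import numFieldNormedType.Exports.
Local Open Scope classical_set_scope.
Local Open Scope ring_scope.

(** * Computability *)

(* Kleene's total recursive functions. Minimization is only applied to regular
   functions, so that every member of the class is total. *)
Inductive recursive : forall n : nat, (n.-tuple nat -> nat) -> Prop :=
| recursive_zero n : recursive (fun _ : n.-tuple nat => 0%N)
| recursive_succ : recursive (fun v : 1.-tuple nat => (thead v).+1)
| recursive_proj n (i : 'I_n) : recursive (fun v : n.-tuple nat => tnth v i)
| recursive_comp m n (f : m.-tuple nat -> nat)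
    (g : 'I_m -> n.-tuple nat -> nat) :
    recursive f -> (forall i, recursive (g i)) ->
    recursive (fun v : n.-tuple nat => f [tuple g i v | i < m])
| recursive_primrec n (f : n.-tuple nat -> nat) (g : n.+2.-tuple nat -> nat) :
    recursive f -> recursive g ->
    recursive (fun v : n.+1.-tuple nat =>
      nat_rect (fun=> nat) (f [tuple of behead v])
        (fun k r => g [tuple of k :: r :: [tuple of behead v]]) (thead v))
| recursive_min n (g : n.+1.-tuple nat -> nat)
    (g0 : forall v : n.-tuple nat, exists k, g [tuple of k :: v] == 0%N) :
    recursive g ->
    recursive (fun v : n.-tuple nat => ex_minn (g0 v)).

(* Bijective base-2 numeration: a bijection between strings and naturals. *)
Fixpoint string_code (s : seq bool) : nat :=
  if s is b :: s' then ((string_code s').*2 + b.+1)%N else 0%N.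

(* The reals [x s] are computable uniformly in the string [s]: a rational
   [(p - q) / (r + 1)] within [2 ^ -k] of [x s] is computed from [s] and [k]. *)
Definition computable_on_strings (R : realType) (x : seq bool -> R) : Prop :=
  exists p q r : 2.-tuple nat -> nat,
    [/\ recursive p, recursive q, recursive r &
        forall (s : seq bool) (k : nat),
          let v := [tuple string_code s; k] in
          `| x s - ((p v)%:R - (q v)%:R) / (r v).+1%:R | <= 2 ^- k].

(** * Measures on Cantor space *)

(* Cantor space with its Borel sigma-algebra. *)
Notation cantor := (g_sigma_algebraType (@open cantor_space)).

Definition restrict_to (w : nat -> bool) (n : nat) : seq bool := mkseq w n.

Definition cylinder (s : seq bool) : set cantor_space :=
  [set w | restrict_to w (size s) = s].

Lemma cylinder_rcons s b :
  cylinder (rcons s b) = cylinder s `&` [set w : cantor_space | w (size s) = b].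
Proof.
apply/seteqP; split => [w|w []]; rewrite /cylinder /restrict_to /= size_rcons.
  by rewrite mkseqS => /rcons_inj[].
by rewrite mkseqS => -> ->.
Qed.

Lemma open_cylinder s : @open cantor_space (cylinder s).
Proof.
elim/last_ind: s => [|s b IHs].
  have -> : cylinder [::] = setT by apply/seteqP; split.
  exact: (@openT cantor_space).
rewrite cylinder_rcons; apply: openI => //.
apply: (@open_comp cantor_space bool (fun w => w (size s)) [set b]) => //.
  by move=> w _; exact: (@proj_continuous nat (fun=> bool) (size s)).
exact: discrete_open.
Qed.

Lemma measurable_cylinder s : @measurable _ cantor (cylinder s).
Proof. by apply: sub_sigma_algebra; exact: open_cylinder. Qed.

Definition level_cylinders (n : nat) : set (set cantor_space) :=
  [set cylinder s | s in [set s | size s = n]].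

(* Cantor space with the sigma-algebra generated by the cylinders of
   strings of length [n]. *)
Notation cantor_level n := (g_sigma_algebraType (level_cylinders n)).

Lemma measurable_level n (A : set cantor_space) :
  @measurable _ (cantor_level n) A -> @measurable _ cantor A.
Proof.
apply: (@smallest_sub _ _ _ (@measurable _ cantor)).
  exact: sigma_algebra_measurable.
by move=> _ [s _ <-]; exact: measurable_cylinder.
Qed.

Section level_restriction.
Local Open Scope ereal_scope.
Context (R : realType) (n : nat).
Variable P : probability cantor R.

Definition level_restriction : set (cantor_level n) -> \bar R := P.

Let level_restriction0 : level_restriction set0 = 0.
Proof. exact: measure0. Qed.

Let level_restriction_ge0 A : 0 <= level_restriction A.
Proof. exact: measure_ge0. Qed.

Let level_restriction_sigma_additive : semi_sigma_additive level_restriction.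
Proof.
move=> F mF tF mUF; apply: (@measure_semi_sigma_additive _ cantor _ P) => //.
- by move=> i; exact: measurable_level (mF i).
- exact: measurable_level mUF.
Qed.

HB.instance Definition _ := isMeasure.Build _ _ _ level_restriction
  level_restriction0 level_restriction_ge0 level_restriction_sigma_additive.

Let level_restriction_setT : level_restriction [set: _] = 1.
Proof. exact: probability_setT. Qed.

HB.instance Definition _ := Measure_isProbability.Build _ _ _
  level_restriction level_restriction_setT.
End level_restriction.
Arguments level_restriction {R} n P.

(* The conditional measure given [cylinder s]; the last argument of
   [mnormalize] is only relevant when [cylinder s] is a null set. *)
Definition conditional (R : realType) (P : probability cantor R)
    (s : seq bool) : probability cantor R :=
  mnormalize (mrestr P (measurable_cylinder s)) P.

Definition mass (R : realType) (P : probability cantor R) (s : seq bool) : R :=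
  fine (P (cylinder s)).

Definition computable_measure (R : realType) (P : probability cantor R) :=
  computable_on_strings (mass P).

Definition full_support (R : realType) (P : probability cantor R) :=
  forall s, 0 < mass P s.

(** * Kullback-Leibler divergence *)

Local Open Scope charge_scope.

Definition KL_divergence d (T : measurableType d) (R : realType)
    (P Q : probability T R) : \bar R :=
  if `[< P `<< Q >] then
    (\int[P]_x lne (('d (charge_of_finite_measure P) '/d Q) x))%E
  else +oo%E.

Definition level_divergence (R : realType) (n : nat)
    (nu mu : probability cantor R) (w : nat -> bool) : \bar R :=
  KL_divergence
    (level_restriction n.+1 (conditional nu (restrict_to w n)))
    (level_restriction n.+1 (conditional mu (restrict_to w n))).

(** * Dyadic martingales *)

Section dyadic.
Context (R : realType).
Variable nu : probability cantor R.
Implicit Types (M L N A : seq bool -> R) (s t : seq bool) (b : bool).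

Definition transition s b : R := mass nu (rcons s b) / mass nu s.

Definition next_mean M s : R :=
  M (rcons s false) * transition s false + M (rcons s true) * transition s true.

Definition dyadic_martingale M : Prop := forall s, M s = next_mean M s.

Definition dyadic_submartingale M : Prop := forall s, M s <= next_mean M s.

Record Doob_decomposition L N A : Prop := {
  Doob_martingale : dyadic_martingale N ;
  Doob_martingale_computable : computable_on_strings N ;
  Doob_predictable_ge0 : forall s, 0 <= A s ;
  Doob_predictable_computable : computable_on_strings A ;
  Doob_predictable_increasing : forall s t, prefix s t -> A s <= A t ;
  Doob_sum : forall s, L s = N s + A s ;
  Doob_init : N [::] = L [::] ;
  Doob_increment : forall t b, A (rcons t b) - A t = next_mean L t - L t }.

End dyadic.

Definition log_ratio (R : realType) (nu mu : probability cantor R)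
    (s : seq bool) : R := - ln (mass mu s / mass nu s).

(* Main.v *)
(* The atoms of the sigma-algebra of level n+1 inside the cylinder of s, where
   |s| = n, are the cylinders of s0 and s1, so the Radon-Nikodym derivative of the
   conditional measures is constant on each of them, equal to the quotient of
   the transition probabilities.  The divergence is thus a sum of two terms,
   which is the expected increment of L at s, i.e. the increment of A.
   Submartingality of L is ln x <= x - 1.
   For the computability of L, note that H_(aN) - H_(bN), with H_n the harmonic
   numbers, is within 1/N of ln (a / b), and that the positivity of the masses
   allows one to search for approximations of prescribed relative precision. *)
Require Import Defs.
From mathcomp Require Import all_boot all_order all_algebra.
From mathcomp Require Import all_classical all_reals all_analysis.
From mathcomp Require Import measurable_realfun zify ring lra.
Set Implicit Arguments.
Unset Strict Implicit.
Unset Printing Implicit Defensive.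
Import Order.TTheory GRing.Theory Num.Theory.
Import numFieldNormedType.Exports.
Local Open Scope classical_set_scope.
Local Open Scope ring_scope.

(** * Computability of the logarithmic ratio *)

Lemma recursive_ext n (f g : n.-tuple nat -> nat) :
  f =1 g -> recursive f -> recursive g.
Proof. by move=> /funext ->. Qed.

(** Curried forms of recursiveness, for ordinary functions of one, two or three numbers. *)
Definition recursive1 (h : nat -> nat) :=
  recursive (fun v : 1.-tuple nat => h (tnth v ord0)).

Definition recursive2 (h : nat -> nat -> nat) :=
  recursive (fun v : 2.-tuple nat => h (tnth v ord0) (tnth v (inord 1))).

Definition recursive3 (h : nat -> nat -> nat -> nat) :=
  recursive (fun v : 3.-tuple nat =>
    h (tnth v ord0) (tnth v (inord 1)) (tnth v (inord 2))).

Lemma tnth_inord n (v : n.+1.-tuple nat) i :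
  (i < n.+1)%N -> tnth v (inord i) = nth 0%N v i.
Proof. by move=> ilt; rewrite (tnth_nth 0%N) inordK. Qed.

Lemma recursive_comp1 n h (f : n.-tuple nat -> nat) :
  recursive1 h -> recursive f -> recursive (fun v => h (f v)).
Proof.
move=> rh rf; apply: recursive_ext (recursive_comp rh (fun=> rf)) => v.
by rewrite tnth_mktuple.
Qed.

Lemma recursive1_succn : recursive1 succn.
Proof. exact: recursive_succ. Qed.

Lemma recursive_const n c : recursive (fun _ : n.-tuple nat => c).
Proof.
elim: c => [|c IHc]; first exact: recursive_zero.
exact: (recursive_comp1 recursive1_succn IHc).
Qed.

(** For an [h] given only on pairs, such as the approximations in [computable_on_strings]. *)
Lemma recursive_comp_pair n (h : 2.-tuple nat -> nat)
    (f g : n.-tuple nat -> nat) :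
  recursive h -> recursive f -> recursive g ->
  recursive (fun v => h [tuple f v; g v]).
Proof.
move=> rh rf rg; pose F (i : 'I_2) := if i == 0%N :> nat then f else g.
have rF i : recursive (F i) by rewrite /F; case: ifP.
apply: recursive_ext (recursive_comp rh rF) => v; congr h.
apply: eq_from_tnth => i; rewrite tnth_mktuple /F !(tnth_nth 0%N) /=.
by case: i => -[|[]].
Qed.

Lemma recursive_comp2 n h (f g : n.-tuple nat -> nat) :
  recursive2 h -> recursive f -> recursive g ->
  recursive (fun v => h (f v) (g v)).
Proof.
move=> rh rf rg; apply: recursive_ext (recursive_comp_pair rh rf rg) => v.
by rewrite tnth_inord.
Qed.

Lemma recursive2_primrec f g (h : nat -> nat -> nat) :
  recursive1 f -> recursive3 g -> h 0%N =1 f ->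
  (forall k y, h k.+1 y = g k (h k y) y) -> recursive2 h.
Proof.
move=> rf rg h0 hS; apply: recursive_ext (recursive_primrec rf rg) => v.
case: v => -[|k [|y []]] //= sz.
rewrite /thead !tnth_inord// !(tnth_nth 0%N) /=.
(* Keeping only the equation [GE] for the step function prevents the induction on [k] from unfolding
   tuples. *)
set G := (G in nat_rect _ _ G).
have GE i r : G i r = g i r y by rewrite /G !tnth_inord.
by clearbody G; elim: k {sz} => [|k IHk] /=; rewrite ?h0 // GE IHk hS.
Qed.

Lemma recursive1_primrec a g (h : nat -> nat) :
  recursive2 g -> h 0%N = a -> (forall k, h k.+1 = g k (h k)) -> recursive1 h.
Proof.
move=> rg h0 hS; have rh : recursive2 (fun k _ => h k).
  apply: (@recursive2_primrec (fun=> a) (fun k r _ => g k r) (fun k _ => h k)) => //.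
  - exact: recursive_const.
  - exact: (recursive_comp2 rg (recursive_proj _) (recursive_proj _)).
exact: (@recursive_comp2 _ (fun k _ => h k) _ _ rh
  (recursive_proj _) (recursive_const _ 0)).
Qed.

Lemma recursive2_addn : recursive2 addn.
Proof.
apply: (@recursive2_primrec id (fun k r y => r.+1) addn) => //.
  exact: recursive_proj.
exact: (recursive_comp1 recursive1_succn (recursive_proj _)).
Qed.

Lemma recursive2_muln : recursive2 muln.
Proof.
apply: (@recursive2_primrec (fun=> 0%N) (fun k r y => y + r)%N muln) => //.
  exact: recursive_zero.
exact: (recursive_comp2 recursive2_addn (recursive_proj _) (recursive_proj _)).
Qed.

Lemma recursive1_predn : recursive1 predn.
Proof.
by apply: (@recursive1_primrec 0%N (fun k r => k) predn) => //; exact: recursive_proj.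
Qed.

Lemma recursive2_subn : recursive2 subn.
Proof.
(* The recursion runs on the subtrahend, which must therefore be the first argument. *)
suff rs : recursive2 (fun k y => y - k)%N.
  exact: (recursive_comp2 rs (recursive_proj _) (recursive_proj _)).
apply: (@recursive2_primrec id (fun k r y => r.-1) (fun k y => y - k)%N).
- exact: recursive_proj.
- exact: (recursive_comp1 recursive1_predn (recursive_proj _)).
- by move=> y; rewrite subn0.
- by move=> k y; rewrite subnS.
Qed.

Lemma recursive1_expn2 : recursive1 (expn 2).
Proof.
apply: (@recursive1_primrec 1%N (fun k r => r + r)%N (expn 2)) => //.
  exact: (recursive_comp2 recursive2_addn (recursive_proj _) (recursive_proj _)).
by move=> k; rewrite expnS mul2n addnn.
Qed.

Lemma recursive1_factorial : recursive1 factorial.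
Proof.
apply: (@recursive1_primrec 1%N (fun k r => k.+1 * r)%N factorial) => //.
apply: (recursive_comp2 recursive2_muln); last exact: recursive_proj.
exact: (recursive_comp1 recursive1_succn (recursive_proj _)).
Qed.

(* [harmonic_num n] is the numerator of the n-th harmonic number over n! *)
Fixpoint harmonic_num (n : nat) : nat :=
  if n is m.+1 then (harmonic_num m * m.+1 + m`!)%N else 0%N.

Lemma recursive1_harmonic_num : recursive1 harmonic_num.
Proof.
apply: (@recursive1_primrec 0%N (fun k r => r * k.+1 + k`!)%N harmonic_num) => //.
apply: (recursive_comp2 recursive2_addn).
  apply: (recursive_comp2 recursive2_muln); first exact: recursive_proj.
  exact: (recursive_comp1 recursive1_succn (recursive_proj _)).
exact: (recursive_comp1 recursive1_factorial (recursive_proj _)).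
Qed.

(** * Estimates for the logarithm *)

Section logarithm.
Context (R : realType).
Implicit Types x y e : R.

Definition harmonic_number (n : nat) : R := (harmonic_num n)%:R / n`!%:R.

Lemma harmonic_numberS n :
  harmonic_number n.+1 = harmonic_number n + n.+1%:R^-1.
Proof.
have n0 : (n`!%:R : R) != 0 by rewrite pnatr_eq0 -lt0n fact_gt0.
have n1 : (n.+1%:R : R) != 0 by rewrite pnatr_eq0.
by rewrite /harmonic_number /= natrD factS !natrM; field; rewrite n0 addrC natr1 n1.
Qed.

Lemma ln_le_subr1 x : 0 < x -> ln x <= x - 1.
Proof.
by move=> x0; rewrite -[X in ln X](subrKC 1) le_ln1Dx// ltrBDr addNr.
Qed.

(** This sequence tends to Euler's constant. *)
Let gamma n : R := harmonic_number n - ln n%:R.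

(** The inequality ln x <= x - 1 at (n+1)/n and at its inverse gives 1/(n+1) <= ln ((n+1)/n) <=
    1/n. *)
Let gammaS n : (0 < n)%N ->
  gamma n.+1 <= gamma n /\ gamma n - n%:R^-1 <= gamma n.+1 - n.+1%:R^-1.
Proof.
move=> n0; have n0' : 0 < n%:R :> R by rewrite ltr0n.
have n1 : 0 < n.+1%:R :> R by rewrite ltr0n.
have := @ln_le_subr1 (n.+1%:R / n%:R) (divr_gt0 n1 n0').
have := @ln_le_subr1 (n%:R / n.+1%:R) (divr_gt0 n0' n1).
rewrite !ln_div ?posrE// /gamma harmonic_numberS.
have -> : n%:R / n.+1%:R - 1 = - n.+1%:R^-1 :> R.
  by rewrite -natr1; field; rewrite natr1 gt_eqF.
have -> : n.+1%:R / n%:R - 1 = n%:R^-1 :> R.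
  by rewrite -natr1; field; rewrite gt_eqF.
move: (n.+1%:R^-1) (n%:R^-1) (ln n.+1%:R) (ln n%:R) => *; split; lra.
Qed.

Let gamma_le m n : (0 < m <= n)%N ->
  gamma n <= gamma m /\ gamma m - m%:R^-1 <= gamma n - n%:R^-1.
Proof.
case/andP=> m0 /subnK <-; elim: (n - m)%N => [//|k [IH1 IH2]].
have /gammaS[] : (0 < k + m)%N by rewrite addn_gt0 m0 orbT.
by rewrite -addSn => ? ?; split; lra.
Qed.

(* With H_n the harmonic numbers, H_n - ln n decreases and H_n - ln n - 1/n
   increases. *)
Lemma harmonic_ln a b N : (0 < a)%N -> (0 < b)%N -> (0 < N)%N ->
  `|ln (a%:R / b%:R) - (harmonic_number (a * N) - harmonic_number (b * N))|
    <= N%:R^-1.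
Proof.
move=> a0 b0 N0.
have -> : ln (a%:R / b%:R) = ln (a * N)%:R - ln (b * N)%:R :> R.
  by rewrite !natrM -ln_div ?posrE ?mulr_gt0 ?ltr0n// -mulf_div divff
    ?mulr1// pnatr_eq0 -lt0n.
(* The error is a difference of [gamma] at [b * N] and [a * N], both at least [N]. For n <= m,
   [gamma n - gamma m] lies between 0 and 1/n - 1/m. *)
suff bound m n : (0 < n)%N -> (N <= n <= m)%N -> `|gamma n - gamma m| <= N%:R^-1.
  have -> : ln (a * N)%:R - ln (b * N)%:R -
      (harmonic_number (a * N) - harmonic_number (b * N)) =
      gamma (b * N) - gamma (a * N) by rewrite /gamma; lra.
  have aN : (0 < a * N)%N by rewrite muln_gt0 a0.
  have bN : (0 < b * N)%N by rewrite muln_gt0 b0.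
  have [ba|/ltnW ab] := leqP (b * N) (a * N).
    by apply: bound => //; rewrite leq_pmull.
  by rewrite distrC; apply: bound => //; rewrite leq_pmull.
move=> n0 /andP[Nn nm]; have /gamma_le[] : (0 < n <= m)%N by rewrite n0.
have : n%:R^-1 <= N%:R^-1 :> R by rewrite lef_pV2 ?posrE ?ltr0n// ler_nat.
have : 0 <= m%:R^-1 :> R by rewrite invr_ge0.
by move=> ? ? ? ?; rewrite ler_norml; lra.
Qed.

(** By ln z <= z - 1 at x/y and y/x: the former is at most 1 + e, the latter at most 1/(1 - e),
    which is at most 1 + 2e because 0 <= e <= 1/2. *)
Lemma ln_dist x y e : 0 < x -> 0 < y -> e <= 2^-1 -> `|x - y| <= e * y ->
  `|ln x - ln y| <= 2 * e.
Proof.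
move=> x0 y0 e2 xy.
have e0 : 0 <= e by rewrite -(pmulr_lge0 _ y0); exact: le_trans xy.
move: xy; rewrite ler_norml => /andP[xy1 xy2].
have := ln_le_subr1 (divr_gt0 x0 y0); have := ln_le_subr1 (divr_gt0 y0 x0).
rewrite !ln_div ?posrE// => lnyx lnxy.
have : x / y <= 1 + e by rewrite ler_pdivrMr//; lra.
have : y / x <= 1 + 2 * e by rewrite ler_pdivrMr//; nra.
by move=> *; rewrite ler_norml; lra.
Qed.
End logarithm.

(** * Rational approximation of logarithms of computable reals *)

(** An unbounded search must succeed on all numbers; surjectivity reduces this to codes of
    strings. *)
Lemma string_code_surj n : exists s, string_code s = n.
Proof.
elim/ltn_ind: n => -[|n] IHn; first by exists [::].
have [|s sE] := IHn (n./2); first by rewrite ltnS leq_half_double; lia.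
exists (odd n :: s) => /=; rewrite sE; lia.
Qed.

(* The precision m is increased until the approximation of [x s] within 2^-m is
   at least 2^(k+1) 2^-m. *)
Lemma computable_ln_approx (R : realType) (x : seq bool -> R) :
  computable_on_strings x -> (forall s, 0 < x s) ->
  exists c d : 2.-tuple nat -> nat,
    [/\ recursive c, recursive d, (forall v, (0 < c v)%N), (forall v, (0 < d v)%N) &
      forall s k v, v = [tuple string_code s; k] ->
        `|ln (x s) - ln ((c v)%:R / (d v)%:R)| <= 2 ^- k].
Proof.
case=> p [q [r [rp rq rr approx]]] x0.
(* A triple is (m, code of s, k), the sought precision m coming first as in [recursive_min]; [V]
   extracts (code of s, m). *)
pose V (v : 3.-tuple nat) := [tuple tnth v (inord 1); tnth v ord0].
(* By truncated subtraction, [g] vanishes exactly when the approximation at precision m is large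
   enough, denominators being cleared. *)
pose g (v : 3.-tuple nat) : nat :=
  ((r (V v)).+1 * 2 ^ (tnth v (inord 2)).+1 - (p (V v) - q (V v)) * 2 ^ tnth v ord0)%N.
have rV h : recursive h -> recursive (fun v => h (V v)).
  by move=> rh; apply: recursive_comp_pair => //; exact: recursive_proj.
have rg : recursive g.
  apply: (recursive_comp2 recursive2_subn); apply: (recursive_comp2 recursive2_muln).
  - exact: (recursive_comp1 recursive1_succn (rV _ rr)).
  - apply: (recursive_comp1 recursive1_expn2).
    exact: (recursive_comp1 recursive1_succn (recursive_proj _)).
  - exact: (recursive_comp2 recursive2_subn (rV _ rp) (rV _ rq)).
  - exact: (recursive_comp1 recursive1_expn2 (recursive_proj _)).
have gE m (v : 2.-tuple nat) : g [tuple of m :: v] = ((r [tuple tnth v ord0; m]).+1 *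
    2 ^ (tnth v (inord 1)).+1 -
    (p [tuple tnth v ord0; m] - q [tuple tnth v ord0; m]) * 2 ^ m)%N.
  have VE : V [tuple of m :: v] = [tuple tnth v ord0; m].
    by rewrite /V tnth_inord//= (tnth_nth 0%N v).
  by rewrite /g VE !tnth_inord.
have g0 (v : 2.-tuple nat) : exists m, g [tuple of m :: v] == 0%N.
  have [s sE] := string_code_surj (tnth v ord0).
  set k := (tnth v (inord 1)).+1.
  (* If 2^m x(s) >= 2^k + 1, then the approximation times 2^m is at least 2^k, since the error 2^-m
     costs at most 1 after scaling. *)
  pose C := (2 ^+ k + 1) / x s.
  have [m Cm] : exists m, C <= 2 ^+ m.
    exists (Num.Def.truncn C).+1.
    apply: le_trans (ltW (truncnS_gt C)) _.
    by rewrite -natrX ler_nat ltnW// ltn_expl.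
  exists m; rewrite gE -sE subn_eq0 -(ler_nat R).
  have := approx s m; rewrite /=.
  set w := [tuple string_code s; m] => xy.
  rewrite !natrM !natrX.
  have two_m : 0 < 2 ^+ m :> R by rewrite exprn_gt0.
  apply: (@le_trans _ _ (((p w)%:R - (q w)%:R) * 2 ^+ m)); last first.
    rewrite ler_pM2r// lerBlDr -natrD ler_nat; lia.
  rewrite mulrC -ler_pdivlMr ?ltr0n// mulrAC.
  move: Cm; rewrite ler_pdivrMr// => Cm.
  move: xy; rewrite ler_norml => /andP[_].
  rewrite -(ler_pM2r two_m) mulVf ?gt_eqF//.
  move: (_ / _) (2 ^+ m) (2 ^+ k) Cm => y tm tk; lra.
pose m v := ex_minn (g0 v).
have rm : recursive m by exact: recursive_min.
pose W (v : 2.-tuple nat) := [tuple tnth v ord0; m v].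
have rW h : recursive h -> recursive (fun v => h (W v)).
  by move=> rh; apply: recursive_comp_pair => //; exact: recursive_proj.
have mP (v : 2.-tuple nat) : ((r (W v)).+1 * 2 ^ (tnth v (inord 1)).+1 <=
    (p (W v) - q (W v)) * 2 ^ m v)%N.
  by rewrite -subn_eq0 -gE /m; case: ex_minnP.
have c0 v : (0 < p (W v) - q (W v))%N.
  have := mP v; case: (_ - _)%N => //.
  by rewrite mul0n leqn0 muln_eq0 expn_eq0.
exists (fun v => p (W v) - q (W v))%N, (fun v => (r (W v)).+1); split => //.
- exact: (recursive_comp2 recursive2_subn (rW _ rp) (rW _ rq)).
- exact: (recursive_comp1 recursive1_succn (rW _ rr)).
move=> s k v vE.
have := approx s (m v); have := mP v; have := c0 v; rewrite /=.
have -> : [tuple string_code s; m v] = W v by rewrite vE.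
have -> : tnth v (inord 1) = k by rewrite vE tnth_inord.
set D := (r (W v)).+1 => PQ mPv xy.
(* [ln_dist] will be applied with relative error 2^-(k+1), which the test passed by [m v]
   guarantees. *)
have -> : 2 ^- k = 2 * 2 ^- k.+1 :> R.
  by rewrite exprS invfM mulrA divff ?mul1r// pnatr_eq0.
have D0 : 0 < D%:R :> R by rewrite ltr0n.
have two0 j : 0 < 2 ^+ j :> R by rewrite exprn_gt0.
apply: ln_dist => //; first by rewrite divr_gt0 ?ltr0n.
  by rewrite lef_pV2 ?posrE// exprS ler_peMr// exprn_ege1// ler1n.
rewrite natrB; last by rewrite ltnW// -subn_gt0.
apply: le_trans xy _; rewrite -natrB; last by rewrite ltnW// -subn_gt0.
move: mPv; rewrite -(ler_nat R) !natrM !natrX => mPv.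
rewrite mulrA ler_pdivlMr// mulrC ler_pdivrMr// -mulrA ler_pdivlMl//.
by rewrite mulrC.
Qed.

(** Each logarithm is replaced by that of a rational within 2^-(k+2), and the logarithm of the
    quotient of the rationals by a difference of harmonic numbers within 1/N = 2^-(k+1); the errors
    add up to 2^-k. *)
Lemma computable_ln_sub (R : realType) (x y : seq bool -> R) :
  computable_on_strings x -> computable_on_strings y ->
  (forall s, 0 < x s) -> (forall s, 0 < y s) ->
  computable_on_strings (fun s => ln (x s) - ln (y s)).
Proof.
move=> cx cy x0 y0.
have [c [d [rc rd c0 d0 xE]]] := computable_ln_approx cx x0.
have [c' [d' [rc' rd' c0' d0' yE]]] := computable_ln_approx cy y0.
pose W (v : 2.-tuple nat) := [tuple tnth v ord0; (tnth v (inord 1)).+2].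
have rW h : recursive h -> recursive (fun v => h (W v)).
  move=> rh; apply: recursive_comp_pair rh (recursive_proj _) _.
  apply: (recursive_comp1 recursive1_succn).
  exact: (recursive_comp1 recursive1_succn (recursive_proj _)).
pose N (v : 2.-tuple nat) := (2 ^ (tnth v (inord 1)).+1)%N.
pose A v := (c (W v) * d' (W v) * N v)%N.
pose B v := (c' (W v) * d (W v) * N v)%N.
have rN : recursive N.
  apply: (recursive_comp1 recursive1_expn2).
  exact: (recursive_comp1 recursive1_succn (recursive_proj _)).
have rM f g : recursive f -> recursive g ->
    recursive (fun v : 2.-tuple nat => f v * g v)%N.
  exact: recursive_comp2 recursive2_muln.
have rA : recursive A by apply: (rM _ _ (rM _ _ _ _) rN); exact: rW.
have rB : recursive B by apply: (rM _ _ (rM _ _ _ _) rN); exact: rW.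
have rfact f : recursive f -> recursive (fun v : 2.-tuple nat => (f v)`!).
  exact: recursive_comp1 recursive1_factorial.
have rharm f : recursive f -> recursive (fun v : 2.-tuple nat => harmonic_num (f v)).
  exact: recursive_comp1 recursive1_harmonic_num.
(* The two harmonic numbers over a common denominator; the predecessor offsets the successor in
   [computable_on_strings]. *)
exists (fun v => harmonic_num (A v) * (B v)`!)%N,
  (fun v => harmonic_num (B v) * (A v)`!)%N, (fun v => ((A v)`! * (B v)`!).-1).
split; [exact: rM (rharm _ rA) (rfact _ rB)|exact: rM (rharm _ rB) (rfact _ rA)| |].
  exact: (recursive_comp1 recursive1_predn (rM _ _ (rfact _ rA) (rfact _ rB))).
move=> s k; set v := [tuple string_code s; k].
have WE : W v = [tuple string_code s; k.+2] by rewrite /W tnth_inord.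
have NE : N v = (2 ^ k.+1)%N by rewrite /N tnth_inord.
cbv zeta; rewrite -/v prednK ?muln_gt0 ?fact_gt0//.
have fact0 j : j`!%:R != 0 :> R by rewrite pnatr_eq0 -lt0n fact_gt0.
have -> : ((harmonic_num (A v) * (B v)`!)%:R - (harmonic_num (B v) * (A v)`!)%:R)
    / ((A v)`! * (B v)`!)%:R = harmonic_number R (A v) - harmonic_number R (B v).
  by rewrite /harmonic_number !natrM; field; rewrite !fact0.
have ab0 : (0 < c (W v) * d' (W v))%N by rewrite muln_gt0 c0 d0'.
have ba0 : (0 < c' (W v) * d (W v))%N by rewrite muln_gt0 c0' d0.
have N0 : (0 < N v)%N by rewrite NE expn_gt0.
have := harmonic_ln R ab0 ba0 N0.
rewrite -/(A v) -/(B v) ln_div ?posrE ?ltr0n// !natrM !lnM ?posrE ?ltr0n//.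
have := xE _ _ _ WE; have := yE _ _ _ WE; rewrite !ln_div ?posrE ?ltr0n//.
have -> : (N v)%:R^-1 = 2^-1 * 2 ^- k :> R by rewrite NE natrX exprS invfM.
rewrite (_ : 2 ^- k.+2 = 4^-1 * 2 ^- k :> R); last first.
  by rewrite !exprS !invfM mulrA -invfM -natrM.
rewrite !ler_norml; move: (2 ^- k) => e /andP[? ?] /andP[? ?] /andP[? ?].
by apply/andP; split; lra.
Qed.

(** * Cylinders and masses *)

Lemma size_restrict_to w n : size (restrict_to w n) = n.
Proof. exact: size_mkseq. Qed.

Lemma restrict_toS w n : restrict_to w n.+1 = rcons (restrict_to w n) (w n).
Proof. exact: mkseqS. Qed.

Lemma cylinder_nonempty s : cylinder s (nth false s).
Proof. by rewrite /cylinder /restrict_to /= mkseq_nth. Qed.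

Lemma cylinder_split s :
  cylinder s = cylinder (rcons s false) `|` cylinder (rcons s true).
Proof.
apply/seteqP; split => w; rewrite !cylinder_rcons.
  by move=> ws; case wb: (w (size s)); [right|left]; split.
by case=> -[].
Qed.

Lemma cylinder_rcons_disjoint s :
  [disjoint cylinder (rcons s false) & cylinder (rcons s true)].
Proof.
apply/disj_setPS => w; rewrite !cylinder_rcons => -[[_ /= wF] [_ /=]].
by rewrite wF.
Qed.

Section mass.
Context (R : realType) (P : probability cantor R).

Lemma mass_EFin s : P (cylinder s) = (mass P s)%:E.
Proof. by rewrite /mass fineK// fin_num_measure//; exact: measurable_cylinder. Qed.

Lemma mass_split s : mass P s = mass P (rcons s false) + mass P (rcons s true).
Proof.
apply: EFin_inj; rewrite EFinD -!mass_EFin cylinder_split measureU//.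
- exact: measurable_cylinder.
- exact: measurable_cylinder.
- exact/eqP/cylinder_rcons_disjoint.
Qed.

Hypothesis full : full_support P.

Lemma transition_gt0 s b : 0 < transition P s b.
Proof. by rewrite divr_gt0. Qed.

Lemma transition_sum s : transition P s false + transition P s true = 1.
Proof. by rewrite -mulrDl -mass_split divff// gt_eqF. Qed.

Lemma conditionalE s A :
  conditional P s A = (P (A `&` cylinder s) * (mass P s)^-1%:E)%E.
Proof.
rewrite /conditional /= /mnormalize/= /mrestr setTI mass_EFin/=.
(* The mass is positive and finite, which rules out the default case of [mnormalize]. *)
by rewrite orbF ifF//; apply/negbTE; rewrite eqe gt_eqF.
Qed.

Lemma conditional_cylinder s b :
  conditional P s (cylinder (rcons s b)) = (transition P s b)%:E.
Proof.
rewrite conditionalE (_ : _ `&` _ = cylinder (rcons s b)) ?mass_EFin//.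
by apply/setIidl; rewrite cylinder_rcons => w [].
Qed.
End mass.

(** * Atoms of the sigma-algebra of a given level *)

(** The sets that cannot separate sequences with the same first n bits form a sigma-algebra
    containing the generators. *)
Lemma measurable_level_atom n (A : set cantor_space) (w w' : cantor_space) :
  @measurable _ (cantor_level n) A -> restrict_to w n = restrict_to w' n ->
  A w -> A w'.
Proof.
move=> mA; move: A mA w w'.
apply: (@smallest_sub _ _ _ [set A : set cantor_space | forall w w',
  restrict_to w n = restrict_to w' n -> A w -> A w']).
- split => [w w' _ []//|A Aa w w' ww' [_ nAw]|F Fa w w' ww' [i _ Fw]].
    by split => // /(Aa _ _ (esym ww')).
  by exists i => //; exact: Fa Fw.
- move=> _ [s /= sn <-] w w' /=; rewrite /cylinder/= sn => ww' <-.
  by rewrite ww'.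
Qed.

(** Such a set is the union of the cylinders of level n that it contains; the union is taken over
    all strings, the others contributing the empty set. *)
Lemma measurable_level_saturated n (A : set cantor_space) :
  (forall w w', restrict_to w n = restrict_to w' n -> A w -> A w') ->
  @measurable _ (cantor_level n) A.
Proof.
move=> Aa; pose F s := if `[< size s = n /\ cylinder s `<=` A >]
  then cylinder s else set0.
rewrite (_ : A = \bigcup_s F s).
  apply: (@countable_bigcupT_measurable _ (cantor_level n)); first exact: countableP.
  move=> s; rewrite /F; case: asboolP => [[sn _]|_]; last exact: measurable0.
  by apply: sub_sigma_algebra; exists s.
apply/seteqP; split => [w Aw|w [s _]]; last first.
  by rewrite /F; case: asboolP => // -[_]; apply.
exists (restrict_to w n) => //; rewrite /F asboolT /cylinder /=.
  by rewrite size_restrict_to.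
rewrite size_restrict_to; split => // w' ww'; exact: Aa (esym ww') Aw.
Qed.

Lemma measurable_fun_level_atom n (R : realType)
    (f : cantor_level n -> \bar R) (w w' : cantor_space) :
  measurable_fun setT f -> restrict_to w n = restrict_to w' n -> f w = f w'.
Proof.
move=> mf ww'; have := mf measurableT _ (emeasurable_set1 (f w)).
by rewrite setTI => /measurable_level_atom /(_ ww') /(_ erefl) /= ->.
Qed.

Lemma measurable_level_cylinder n s :
  size s = n -> @measurable _ (cantor_level n) (cylinder s).
Proof. by move=> sn; apply: sub_sigma_algebra; exists s. Qed.

Lemma integral_level_cylinder n (R : realType)
    (P : {measure set (cantor_level n) -> \bar R})
    (f : cantor_level n -> \bar R) s w :
  measurable_fun setT f -> size s = n -> cylinder s w ->
  (\int[P]_(x in cylinder s) f x = f w * P (cylinder s))%E.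
Proof.
move=> mf sn sw; rewrite -(integral_cst P (measurable_level_cylinder sn)).
apply: eq_integral => x /set_mem sx /=.
by apply: measurable_fun_level_atom => //; rewrite -sn sx sw.
Qed.

(** * Divergence of the conditional measures *)

Section conditional_divergence.
Context (R : realType) (nu mu : probability cantor R).
Hypotheses (nu_full : full_support nu) (mu_full : full_support mu).
Variables (s : seq bool) (n : nat).
Hypothesis sn : size s = n.

Let P : probability (cantor_level n.+1) R :=
  level_restriction n.+1 (conditional nu s).
Let Q : probability (cantor_level n.+1) R :=
  level_restriction n.+1 (conditional mu s).

Let size_child b : size (rcons s b) = n.+1.
Proof. by rewrite size_rcons sn. Qed.

Let P_child b : P (cylinder (rcons s b)) = (transition nu s b)%:E.
Proof. exact: conditional_cylinder. Qed.

Let Q_child b : Q (cylinder (rcons s b)) = (transition mu s b)%:E.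
Proof. exact: conditional_cylinder. Qed.

(** A measurable set meeting a child cylinder contains it, and [Q] charges both children. Hence a
    [Q]-null set misses the cylinder of [s], which carries [P]. *)
Lemma level_restriction_dominates : P `<< Q.
Proof.
apply/null_content_dominatesP => A mA QA0.
have A_child b : A `&` cylinder (rcons s b) = set0.
  rewrite -subset0 => w [Aw sw].
  have : (Q (cylinder (rcons s b)) <= Q A)%E.
    apply: le_measure; rewrite ?inE//.
      exact: measurable_level_cylinder.
    move=> w' sw'; apply: (measurable_level_atom mA _ Aw).
    by rewrite -(size_child b) sw sw'.
  by rewrite QA0 Q_child lee_fin leNgt transition_gt0.
rewrite [LHS]conditionalE// (cylinder_split s) setIUr !A_child setU0.
by rewrite measure0 mul0e.
Qed.

Local Notation f := (Radon_Nikodym (charge_of_finite_measure P) Q).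

Let f_integrable : Q.-integrable setT f.
Proof. by apply: Radon_Nikodym_integrable; exact: level_restriction_dominates. Qed.

Let mf : measurable_fun setT f.
Proof. exact: measurable_int f_integrable. Qed.

(** The point [nth false (rcons s b)] represents the child cylinder. As [f] is constant there, its
    integral is this value times the [Q]-mass, and it equals the [P]-mass. *)
Lemma Radon_Nikodym_level b :
  f (nth false (rcons s b)) = (transition nu s b / transition mu s b)%:E.
Proof.
have := @Radon_Nikodym_integral _ _ _ (charge_of_finite_measure P) Q
  (cylinder (rcons s b)) level_restriction_dominates
  (measurable_level_cylinder (size_child b)).
rewrite (integral_level_cylinder _ mf (size_child b) (cylinder_nonempty _)).
rewrite [X in (_ * X)%E]Q_child [X in X = _]P_child.
have /fineK <- : f (nth false (rcons s b)) \is a fin_num.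
  by apply: Radon_Nikodym_fin_num; exact: level_restriction_dominates.
rewrite -EFinM => -[->]; rewrite mulfK// gt_eqF//; exact: transition_gt0.
Qed.

(** The composite is constant on atoms because [f] is, so its preimages are saturated. *)
Let mlnf : measurable_fun setT (@lne R \o f).
Proof.
move=> _ Y _; rewrite setTI; apply: measurable_level_saturated => w w' ww' /=.
by rewrite (measurable_fun_level_atom mf ww').
Qed.

Lemma KL_divergence_conditional :
  KL_divergence P Q =
  (next_mean nu (log_ratio nu mu) s - log_ratio nu mu s)%:E.
Proof.
rewrite /KL_divergence asboolT; last exact: level_restriction_dominates.
pose B := cylinder (rcons s false) `|` cylinder (rcons s true).
have mC b := measurable_level_cylinder (size_child b).
have mB : @measurable _ (cantor_level n.+1) B by exact: measurableU.
rewrite -(setUv B) integral_setU//; first last.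
- by apply/disj_setPS; rewrite setICr.
- exact: measurable_funS mlnf.
- exact: measurableC.
(* [B] is the cylinder of [s], so its complement is [P]-null. *)
rewrite [X in (_ + X)%E](null_set_integral (measurableC mB)); first last.
- rewrite [LHS]conditionalE// /B -cylinder_split setICl.
  by rewrite measure0 mul0e.
- exact: measurable_funS mlnf.
rewrite adde0 integral_setU//; first last.
- exact: cylinder_rcons_disjoint.
- exact: measurable_funS mlnf.
rewrite !(integral_level_cylinder _ mlnf (size_child _) (cylinder_nonempty _)).
rewrite /= !Radon_Nikodym_level !P_child.
rewrite !lne_EFin ?divr_gt0 ?transition_gt0// -!EFinM -EFinD; congr _%:E.
rewrite /next_mean /log_ratio !ln_div ?posrE ?transition_gt0 //.
(* The weights sum to one, so the logarithms of the masses at [s] get the same coefficient on both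
   sides. *)
have /(canRL (addrK _)) -> := transition_sum nu_full s.
ring.
Qed.

End conditional_divergence.

(** * The submartingale property and the theorem *)

Lemma dyadic_submartingale_log_ratio (R : realType) (nu mu : probability cantor R) :
  full_support nu -> full_support mu ->
  dyadic_submartingale nu (log_ratio nu mu).
Proof.
move=> nu_full mu_full s.
have muE b : mass mu (rcons s b) = transition mu s b * mass mu s.
  by rewrite divfK// gt_eqF.
have nuE b : mass nu (rcons s b) = transition nu s b * mass nu s.
  by rewrite divfK// gt_eqF.
have tmu b := transition_gt0 mu_full s b.
have tnu b := transition_gt0 nu_full s b.
(* This is ln x <= x - 1 at the quotient of transition probabilities, weighted by [nu]. Summed over
   [b], the correction terms cancel, both families of transition probabilities having sum one. *)
have child b : (log_ratio nu mu s + 1) * transition nu s b - transition mu s b <=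
    log_ratio nu mu (rcons s b) * transition nu s b.
  rewrite /log_ratio (_ : _ / mass nu (rcons s b) =
    (mass mu s / mass nu s) * (transition mu s b / transition nu s b)).
    rewrite [ln (_ * (_ / _))]lnM ?posrE ?divr_gt0//.
    have ln_le : ln (transition mu s b / transition nu s b) * transition nu s b
        <= transition mu s b - transition nu s b.
      by rewrite -ler_pdivlMr// mulrBl divff ?gt_eqF// ln_le_subr1// divr_gt0.
    lra.
  by rewrite nuE muE; field; rewrite !gt_eqF.
rewrite /next_mean; have := child false; have := child true.
have /(canRL (addrK _)) -> := transition_sum nu_full s.
have /(canRL (addrK _)) -> := transition_sum mu_full s.
lra.
Qed.

Theorem theorem3p4 (R : realType) (nu mu : probability cantor R)
    (nu_computable : computable_measure nu)
    (mu_computable : computable_measure mu)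
    (nu_full : full_support nu) (mu_full : full_support mu) :
  [/\ computable_on_strings (log_ratio nu mu),
      dyadic_submartingale nu (log_ratio nu mu) &
      forall N A : seq bool -> R,
        Doob_decomposition nu (log_ratio nu mu) N A ->
        forall (n : nat) (w : nat -> bool),
          level_divergence n nu mu w =
          (A (restrict_to w n.+1) - A (restrict_to w n))%:E].
Proof.
split.
- have -> : log_ratio nu mu = fun s => ln (mass nu s) - ln (mass mu s).
    by apply/funext => s; rewrite /log_ratio ln_div ?posrE// opprB.
  exact: computable_ln_sub.
- exact: dyadic_submartingale_log_ratio.
(* The increment of [A] is the same for both values of the bit [w n]: it is the expected increment
   of L. *)
- move=> N A doob n w; rewrite restrict_toS (Doob_increment doob).
  exact: KL_divergence_conditional (size_restrict_to w n).
Qed.
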